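(* Let $k$ be a positive integer and let $p$ be a prime with $p\equiv 5 \pmod 6$. Let $r$ be a non-negative integer such that $p$ divides $6r+5$. Then for all integers $n\geq 0$, $$\bar{B}_{2,9}\left(18p^{k+1}n+18pr+15p\right)\equiv (-p)\cdot \bar{B}_{2,9}\left(18p^{k-1}n+\frac{18r+15}{p}\right) \pmod 3.$$
   Context: An overpartition of a positive integer $n$ is a partition of $n$ in which the first occurrence of each distinct part may be overlined. For coprime integers $\ell_1,\ell_2>1$, $\bar{B}_{\ell_1,\ell_2}(n)$ denotes the number of overpartitions of $n$ in which no part is divisible by $\ell_1$ or by $\ell_2$, with $\bar{B}_{\ell_1,\ell_2}(0)=1$. *)

(* Defs.v *)
From mathcomp Require Import all_boot all_order all_algebra.

Set Implicit Arguments.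
Unset Strict Implicit.
Unset Printing Implicit Defensive.

(* A pair (a, b) is a part of size a, overlined iff b = true.  In a weakly
   decreasing list equal parts are adjacent, so "only first occurrences may be
   overlined" says that a part equal to its predecessor is not overlined. *)
Definition overpart_rel (x y : nat * bool) : bool :=
  (y.1 < x.1) || ((y.1 == x.1) && ~~ y.2).

Definition is_overpartition (n : nat) (s : seq (nat * bool)) : bool :=
  [&& sorted overpart_rel s, all (fun x => 0 < x.1) s
    & sumn [seq x.1 | x <- s] == n].

Definition regular2 (l1 l2 : nat) (s : seq (nat * bool)) : bool :=
  all (fun x => ~~ (l1 %| x.1) && ~~ (l2 %| x.1)) s.

Definition bseq_parts (n : nat) (s : {bseq n of 'I_n.+1 * bool}) :
    seq (nat * bool) :=
  [seq (nat_of_ord x.1, x.2) | x <- s].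

(* An overpartition of n has at most n parts, each at most n, so all of them are
   of the form bseq_parts s; see overpartition_bseq and bseq_parts_inj. *)
Definition Bbar (l1 l2 n : nat) : nat :=
  #|[set s : {bseq n of 'I_n.+1 * bool} |
      is_overpartition n (bseq_parts s) && regular2 l1 l2 (bseq_parts s)]|.

Lemma bseq_parts_inj n : injective (@bseq_parts n).
Proof.
move=> s t /inj_map eq_st; apply/val_inj/eq_st => -[i b] [j c] /= [ij ->].
by congr (_, _); apply: val_inj.
Qed.

Lemma overpartition_bseq n s :
  is_overpartition n s -> exists t, @bseq_parts n t = s.
Proof.
move=> /and3P[_ pos /eqP sum_n].
have [szs les] : size s <= n /\ all (fun x => x.1 < n.+1) s.
  rewrite -sum_n; elim: s pos {sum_n} => //= x s IHs /andP[x0 /IHs[szs les]].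
  split; first by rewrite -add1n leq_add.
  rewrite ltnS leq_addr /=; apply: sub_all les => y; rewrite !ltnS => /leq_trans.
  by apply; apply: leq_addl.
pose u := [seq ((inord x.1 : 'I_n.+1), x.2) | x <- s].
have szu : size u <= n by rewrite size_map.
exists (Bseq szu); rewrite /bseq_parts /= /u -map_comp.
rewrite -[RHS]map_id; apply/eq_in_map => -[a b] /(allP les) /= an.
by rewrite inordK.
Qed.

Lemma Bbar0 l1 l2 : Bbar l1 l2 0 = 1.
Proof.
apply/eqP/cards1P; exists ([bseq] : {bseq 0 of 'I_1 * bool}).
by apply/setP => s; rewrite !inE [s]bseq0 eqxx.
Qed.

(* Main.v *)
(** Over F_3 every power series satisfies f(q)^3 = f(q^3).  Gauss's product for
    phi(-q) = sum_x (-1)^x q^(x^2), obtained from a finite identity of Shanks,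
    turns the product for F = sum_n B(n) q^n into F phi(-q) phi(-q^18) =
    phi(-q^2) phi(-q^9), so F phi(-q^2)^8 = phi(-q)^8 modulo 3.

    Modulo 3, phi(-q)^4 = phi(-q) phi(-q^3) counts the representations g(N) of
    N by x^2 + 3 y^2 up to sign.  Multiplication by cube roots of unity in
    Z[(1 + sqrt -3)/2] shows that 3 divides g(N) for N > 0 even and that
    2 g(2i + 1) is the i-th coefficient of Psi(q) Psi(q^3), where
    Psi = sum_(k in Z) q^(k (k + 1) / 2).  An isometry of z^2 + 8 x^2 gives the
    exponents 1 mod 3 of Psi(q) phi(-q).  Together these yield
    B(3m) = - g(m) modulo 3 for m odd.  As p = 2 mod 3 is inert in Q(sqrt -3),
    g(p^2 m) = g(m), which is the claim since - p = 1 modulo 3. *)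

From HB Require Import structures.
Require Import Defs.
From mathcomp Require Import all_boot all_order all_algebra.
From mathcomp Require boolp.
From mathcomp Require Import ring zify.

Set Implicit Arguments.
Unset Strict Implicit.
Unset Printing Implicit Defensive.

Import Order.TTheory GRing.Theory Num.Theory.

(** * Formal power series *)

(** A record keeps the convolution product apart from pointwise operations on [nat -> R]. *)
Record fps (R : Type) := Fps { coefs :> nat -> R }.

Section FpsRing.
Local Open Scope ring_scope.
Variable R : comNzRingType.
Implicit Types f g h u : fps R.

Lemma fpsP f g : (forall n, f n = g n) -> f = g.
Proof. by case: f g => [f] [g] /= /boolp.funext ->. Qed.

HB.instance Definition _ := boolp.gen_eqMixin (fps R).
HB.instance Definition _ := boolp.gen_choiceMixin (fps R).

Definition fps_add f g := Fps (fun n => f n + g n).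
Definition fps_opp f := Fps (fun n => - f n).
Definition fps_mul f g := Fps (fun n => \sum_(i < n.+1) f i * g (n - i)%N).
Definition fps_const (c : R) := Fps (fun n => if n == 0%N then c else 0).

Definition ptrunc N f : {poly R} := \poly_(i < N) f i.

(** Low coefficients of a product depend only on truncations, so associativity and commutativity are
    inherited from polynomials. *)
Lemma ptruncM N n f g : (n < N)%N ->
  fps_mul f g n = (ptrunc N f * ptrunc N g)`_n.
Proof.
move=> ltnN; rewrite coefM /=; apply: eq_bigr => i _; rewrite !coef_poly.
by rewrite (leq_ltn_trans _ ltnN) ?(leq_ltn_trans _ ltnN) ?leq_subr // -ltnS.
Qed.

Lemma coef_mul_ptrunc N n (p q p' q' : {poly R}) : (n < N)%N ->
    (forall i, (i < N)%N -> p`_i = p'`_i) ->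
    (forall i, (i < N)%N -> q`_i = q'`_i) ->
  (p * q)`_n = (p' * q')`_n.
Proof.
move=> ltnN eqp eqq; rewrite !coefM; apply: eq_bigr => i _.
have lti : (i < N)%N by rewrite (leq_ltn_trans _ ltnN) // -ltnS.
by rewrite eqp // eqq // (leq_ltn_trans _ ltnN) ?leq_subr.
Qed.

Lemma coef_ptruncM N n f g : (n < N)%N ->
  (ptrunc N (fps_mul f g))`_n = (ptrunc N f * ptrunc N g)`_n.
Proof. by move=> ltnN; rewrite coef_poly ltnN (ptruncM _ _ ltnN). Qed.

Fact fps_addA : associative fps_add.
Proof. by move=> f g h; apply: fpsP => n /=; rewrite addrA. Qed.
Fact fps_addC : commutative fps_add.
Proof. by move=> f g; apply: fpsP => n /=; rewrite addrC. Qed.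
Fact fps_add0 : left_id (fps_const 0) fps_add.
Proof. by move=> f; apply: fpsP => n /=; rewrite if_same add0r. Qed.
Fact fps_addN : left_inverse (fps_const 0) fps_opp fps_add.
Proof. by move=> f; apply: fpsP => n /=; rewrite if_same addNr. Qed.

HB.instance Definition _ :=
  GRing.isZmodule.Build (fps R) fps_addA fps_addC fps_add0 fps_addN.

Fact fps_mulA : associative fps_mul.
Proof.
move=> f g h; apply: fpsP => n; rewrite !(@ptruncM n.+1) //.
rewrite (coef_mul_ptrunc (p' := ptrunc n.+1 f)
  (q' := ptrunc n.+1 g * ptrunc n.+1 h) (ltnSn n)) ?mulrA //; last first.
  by move=> i lti; rewrite coef_ptruncM.
apply: (coef_mul_ptrunc (ltnSn n)) => // i lti.
by rewrite coef_ptruncM.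
Qed.

Fact fps_mulC : commutative fps_mul.
Proof. by move=> f g; apply: fpsP => n; rewrite !(@ptruncM n.+1) // mulrC. Qed.

Fact fps_mul1 : left_id (fps_const 1) fps_mul.
Proof.
move=> f; apply: fpsP => n /=; rewrite big_ord_recl /= mul1r subn0.
by rewrite big1 ?addr0 // => i _; rewrite mul0r.
Qed.

Fact fps_mulDl : left_distributive fps_mul (@fps_add).
Proof.
move=> f g h; apply: fpsP => n /=; rewrite -big_split /=.
by apply: eq_bigr => i _; rewrite mulrDl.
Qed.

Fact fps_one_neq0 : fps_const 1 != fps_const 0.
Proof.
apply/eqP => /(congr1 (fun f : fps R => f 0%N)) /= /eqP.
by rewrite oner_eq0.
Qed.

HB.instance Definition _ :=
  GRing.Zmodule_isComNzRing.Build (fps R)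
    fps_mulA fps_mulC fps_mul1 fps_mulDl fps_one_neq0.

Lemma fpsDE f g n : (f + g) n = f n + g n. Proof. by []. Qed.
Lemma fpsNE f n : (- f) n = - f n. Proof. by []. Qed.
Lemma fpsBE f g n : (f - g) n = f n - g n. Proof. by []. Qed.
Lemma fps0E n : (0 : fps R) n = 0. Proof. by rewrite /= if_same. Qed.
Lemma fps1E n : (1 : fps R) n = (n == 0%N)%:R.
Proof. by rewrite /=; case: eqP. Qed.
Lemma fpsME f g n : (f * g) n = \sum_(i < n.+1) f i * g (n - i)%N.
Proof. by []. Qed.
Lemma fps_sumE I (r : seq I) (P : pred I) (F : I -> fps R) n :
  (\sum_(i <- r | P i) F i) n = \sum_(i <- r | P i) F i n.
Proof.
by apply: (big_ind2 (fun (f : fps R) x => f n = x)) => // [|f x g y <- <-];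
  rewrite ?fps0E.
Qed.

Definition fpsXn k : fps R := Fps (fun n => (n == k)%:R).

Lemma fpsXnME k f n : (fpsXn k * f) n = if (k <= n)%N then f (n - k)%N else 0.
Proof.
rewrite fpsME /=; case: leqP => [lekn|ltnk].
  rewrite (bigD1 (Ordinal (lekn : (k < n.+1)%N))) //= eqxx mul1r.
  rewrite big1 ?addr0 // => i; rewrite -val_eqE /= => /negbTE ->.
  by rewrite mul0r.
rewrite big1 // => i _; case: eqP => [eqik|]; last by rewrite mul0r.
by move: (ltn_ord i); rewrite eqik ltnS leqNgt ltnk.
Qed.

Lemma fpsXnM k l : fpsXn k * fpsXn l = fpsXn (k + l)%N.
Proof.
apply: fpsP => n; rewrite fpsXnME /=; case: leqP => [lekn|ltnk].
  by congr (nat_of_bool _)%:R; apply/eqP/eqP; lia.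
by case: eqP => //; lia.
Qed.

Lemma fpsXnX k l : fpsXn k ^+ l = fpsXn (k * l)%N.
Proof.
elim: l => [|l IHl]; last by rewrite exprS IHl fpsXnM mulnS.
by rewrite muln0 expr0; apply: fpsP => n; rewrite fps1E.
Qed.

(** Congruence modulo q^N, which lets finite products stand in for infinite ones. *)
Definition fps_eqmod N f g := forall n, (n < N)%N -> f n = g n.

Lemma eqmod_refl N f : fps_eqmod N f f. Proof. by []. Qed.
Lemma eqmod_sym N f g : fps_eqmod N f g -> fps_eqmod N g f.
Proof. by move=> e n /e. Qed.
Lemma eqmod_trans N g f h :
  fps_eqmod N f g -> fps_eqmod N g h -> fps_eqmod N f h.
Proof. by move=> e1 e2 n lt; rewrite e1 // e2. Qed.

Lemma eqmodM N f g f' g' :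
  fps_eqmod N f f' -> fps_eqmod N g g' -> fps_eqmod N (f * g) (f' * g').
Proof.
move=> ef eg n ltn; rewrite !fpsME; apply: eq_bigr => i _.
by rewrite ef ?eg //; move: (ltn_ord i); lia.
Qed.

Lemma eqmod_le N M f g : (N <= M)%N -> fps_eqmod M f g -> fps_eqmod N f g.
Proof. by move=> leNM e n lt; apply: e; apply: leq_trans leNM. Qed.

(** Strong induction on the degree: all terms of the two convolutions but the leading one already
    agree. *)
Lemma eqmod_mulIf N u f g : u 0%N = 1 ->
  fps_eqmod N (u * f) (u * g) -> fps_eqmod N f g.
Proof.
move=> u0 e n; elim/ltn_ind: n => n IHn ltnN.
move: (e n ltnN); rewrite !fpsME !big_ord_recl /= u0 !mul1r subn0.
have -> : \sum_(i < n) u (lift ord0 i) * f (n - lift ord0 i)%N =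
          \sum_(i < n) u (lift ord0 i) * g (n - lift ord0 i)%N.
  by apply: eq_bigr => i _; rewrite IHn // /lift /= /bump /=;
    move: (ltn_ord i); lia.
by move/addIr.
Qed.

Lemma fps_mulIf u f g : u 0%N = 1 -> u * f = u * g -> f = g.
Proof.
move=> u0 e; apply: fpsP => n.
by apply: (@eqmod_mulIf n.+1 u) => // i _; rewrite e.
Qed.

Lemma fpsM0 f g : (f * g) 0%N = f 0%N * g 0%N.
Proof. by rewrite fpsME big_ord1. Qed.

Lemma fpsX_0 f k : f 0%N = 1 -> (f ^+ k) 0%N = 1.
Proof.
by move=> f0; elim: k => // k IHk; rewrite exprS fpsM0 f0 IHk mulr1.
Qed.

(** For [r < k], [diss k r] extracts the exponents congruent to [r] modulo [k]; [dilate k f] is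
    f(q^k). *)
Definition diss k r f := Fps (fun n => f (k * n + r)%N).
Definition dilate k f := Fps (fun n => if (k %| n)%N then f (n %/ k)%N else 0).

Lemma dissE k r f n : diss k r f n = f (k * n + r)%N. Proof. by []. Qed.

Lemma dilateE k f n :
  dilate k f n = if (k %| n)%N then f (n %/ k)%N else 0.
Proof. by []. Qed.

(** A factor in q^k preserves residues of exponents modulo [k], so it passes through the
    extraction. *)
Lemma diss_dilateM k r f g : (r < k)%N ->
  diss k r (dilate k f * g) = f * diss k r g.
Proof.
move=> ltrk; have k0 : (0 < k)%N by apply: leq_trans ltrk.
apply: fpsP => n; rewrite [LHS]fpsME fpsME /=.
pose F i := (if (k %| i)%N then f (i %/ k)%N else 0) * g (k * n + r - i)%N.
rewrite -(big_mkord xpredT F) -(big_mkord xpredT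
  (fun i => f i * g (k * (n - i) + r)%N)).
rewrite (bigID (dvdn k)) /= [X in _ + X]big1 ?addr0; last first.
  by move=> i /negbTE ki; rewrite /F ki mul0r.
(* The multiples of [k] up to [k * n + r] are the [k * j] with [j <= n], because [r < k]. *)
rewrite -big_filter.
have -> : \sum_(0 <= i < n.+1) f i * g (k * (n - i) + r)%N =
    \sum_(i <- map (muln k) (index_iota 0 n.+1)) F i.
  rewrite big_map; apply: eq_big_nat => i /andP[_ lti].
  by rewrite /F dvdn_mulr // mulKn // mulnBr addnBAC // leq_mul2l -ltnS lti orbT.
apply: perm_big; apply: uniq_perm.
- by rewrite filter_uniq // iota_uniq.
- by rewrite map_inj_uniq ?iota_uniq // => x y /eqP; rewrite eqn_pmul2l // => /eqP.
move=> i; rewrite mem_filter mem_index_iota; apply/andP/mapP.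
  move=> [/dvdnP[j ->]] /= ltj; exists j; last by rewrite mulnC.
  rewrite mem_index_iota /=.
  rewrite -(ltn_pmul2l k0) mulnC (leq_ltn_trans (_ : _ <= k * n + r)%N) //.
  by rewrite mulnS addnC ltn_add2r.
case=> j; rewrite mem_index_iota /= => ltj ->; rewrite dvdn_mulr //; split=> //=.
by rewrite ltnS (leq_trans _ (leq_addr _ _)) // leq_mul2l -ltnS ltj orbT.
Qed.

Lemma diss_dilateXM k r f g m : (r < k)%N ->
  diss k r (dilate k f ^+ m * g) = f ^+ m * diss k r g.
Proof.
move=> ltrk; elim: m => [|m IHm]; first by rewrite !expr0 !mul1r.
by rewrite !exprS -!mulrA diss_dilateM // IHm.
Qed.

End FpsRing.

(** * Cubing power series over F_3 *)

Section Frobenius.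
Local Open Scope ring_scope.

(** Frobenius is applied to a polynomial truncation; it fixes the coefficients, as c^3 = c in
    F_3. *)
Lemma fps_cube (f : fps 'F_3) : f ^+ 3 = dilate 3 f.
Proof.
have ch3 : 3%N \in [pchar {poly 'F_3}] by rewrite pchar_poly; apply: pchar_Fp.
apply: fpsP => n.
have -> : (f ^+ 3) n = (ptrunc n.+1 f ^+ 3)`_n.
  rewrite !exprS expr0 !mulr1.
  rewrite (@ptruncM _ n.+1 n f (f * f)) //.
  apply: (coef_mul_ptrunc (ltnSn n)) => // i lti.
  exact: (coef_ptruncM f f lti).
rewrite /ptrunc poly_def -(pFrobenius_autE ch3) rmorph_sum /=.
have -> : \sum_(i < n.+1) pFrobenius_aut ch3 (f i *: 'X^i) =
          \sum_(i < n.+1) f i *: 'X^(3 * i) :> {poly 'F_3}.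
  apply: eq_bigr => i _; rewrite pFrobenius_autE exprZn -exprM mulnC.
  by congr (_ *: _); case: (f i) => [[|[|[|]]]] // ?; apply: val_inj.
rewrite coef_sum; case: ifP => [/dvdnP[m def_n]|n3].
  have ltm : (m < n.+1)%N by lia.
  have -> : (n %/ 3 = m)%N by rewrite def_n mulnK.
  rewrite (bigD1 (Ordinal ltm)) //= coefZ coefXn.
  have -> : (n == 3 * m)%N by rewrite def_n mulnC.
  rewrite mulr1 big1 ?addr0 // => i; rewrite -val_eqE /= => nim.
  by rewrite coefZ coefXn; case: eqP => [|_]; [lia | rewrite mulr0].
rewrite big1 // => i _; rewrite coefZ coefXn; case: eqP => [eni|]; last by rewrite mulr0.
by move/negP: n3; case; rewrite {1}eni dvdn_mulr.
Qed.

End Frobenius.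

(** * Overpartitions *)

Section Overpartitions.
Variable A : pred nat.

Definition marked m : seq (nat * bool) :=
  [seq (j, b) | j <- iota 1 m, b <- [:: true; false]].

Lemma marked_uniq m : uniq (marked m).
Proof. by rewrite allpairs_uniq ?iota_uniq // => -[a b] [c d]. Qed.

Lemma mem_marked m y : (y \in marked m) = (0 < y.1 <= m).
Proof.
case: y => j b; have -> : (0 < j <= m) = (j \in iota 1 m) by rewrite mem_iota add1n.
apply/allpairsP/idP => [[[j' b'] /= [jm _ [-> _]]] //|jm].
by exists (j, b); split=> //; case: (b).
Qed.

(* [s] may follow a part of size [m]; [k] bounds the number of parts. *)
Fixpoint ovps k m n : seq (seq (nat * bool)) :=
  (if n == 0 then [:: [::]] else [::]) ++
  if k is k'.+1 then
    [seq y :: s | y <- [seq y <- marked m |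
                         [&& overpart_rel (m, true) y, A y.1 & y.1 <= n]],
                  s <- ovps k' y.1 (n - y.1)]
  else [::].

Lemma path_overpart_rel m b c s :
  path overpart_rel (m, b) s = path overpart_rel (m, c) s.
Proof. by case: s. Qed.

Lemma mem_ovps k m n s : (s \in ovps k m n) =
  [&& size s <= k, path overpart_rel (m, true) s, all (fun x => 0 < x.1) s,
      all (fun x => A x.1) s & sumn [seq x.1 | x <- s] == n].
Proof.
elim: k m n s => [|k IHk] m n s.
  rewrite /= cats0; case: s => [|y s] /=; first by case: n.
  by case: n.
rewrite /= mem_cat; case: s => [|y s] /=.
  rewrite orbC (_ : _ \in _ = false) /=; first by case: n.
  by apply/negbTE/negP => /allpairsPdep[? [? []]].
rewrite (_ : y :: s \in (if _ then _ else _) = false) /=; last by case: n.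
apply/allpairsPdep/idP => [[z [t [zm tL [-> ->]]]]|].
  move: zm tL; rewrite mem_filter mem_marked IHk ltnS.
  move=> /andP[/and3P[-> -> le_zn] /andP[-> _]] /and5P[-> pt -> -> /eqP sum_t] /=.
  rewrite sum_t subnKC // eqxx !andbT.
  by case: z pt {sum_t le_zn} => j b; rewrite (path_overpart_rel _ _ true).
move=> /and5P[szs /andP[rel_y ps] /andP[y0 pos] /andP[Ay As] /eqP sum_n].
exists y, s; rewrite mem_filter mem_marked IHk rel_y Ay y0 -sum_n leq_addr addKn.
rewrite -[size s <= k]ltnS szs pos As eqxx /= andbT; split=> //.
  by move: rel_y; rewrite /overpart_rel /= => /orP[/ltnW|/andP[/eqP ->]].
by case: y ps {rel_y y0 Ay sum_n} => j b; rewrite (path_overpart_rel _ _ true) => ->.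
Qed.

Lemma ovps_uniq k m n : uniq (ovps k m n).
Proof.
elim: k m n => [|k IHk] m n /=; first by case: n.
rewrite cat_uniq; apply/and3P; split; first by case: n.
  by apply/hasPn => s /allpairsPdep[y [t [_ _ ->]]]; case: (n).
apply: allpairs_uniq_dep => [|y _|]; first by rewrite filter_uniq ?marked_uniq.
  exact: IHk.
by move=> [y t] [y' t'] _ _ /= [-> ->].
Qed.

(** Such a list may follow a part [m], so this counts overpartitions of [n] with parts in [A], at
    most [m], in which [m] is never overlined. At most [n] parts occur, since parts are positive. *)
Definition novps m n := size (ovps n m n).

Lemma size_ovps k m n : n <= k -> size (ovps k m n) = novps m n.
Proof.
move=> le_nk; apply/perm_size/uniq_perm; rewrite ?ovps_uniq // => s.
rewrite !mem_ovps; apply: andb_id2r => /and4P[_ pos _ /eqP sum_n].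
have le_sn : size s <= n.
  rewrite -sum_n; elim: s pos {sum_n} => //= x s IHs /andP[x0 /IHs le_s].
  by rewrite -add1n leq_add.
by rewrite le_sn (leq_trans le_sn).
Qed.

Lemma novps_rec m n : novps m n = (n == 0) +
  \sum_(y <- marked m | overpart_rel (m, true) y && A y.1)
    (if y.1 <= n then novps y.1 (n - y.1) else 0).
Proof.
rewrite -(@size_ovps n.+1) // /= size_cat; congr (_ + _); first by case: n.
rewrite size_allpairs_dep sumnE big_map big_filter -big_mkcondr /=.
by apply: eq_big => y => [|_]; rewrite ?andbA // size_ovps ?leq_subr.
Qed.

Section Series.
Local Open Scope ring_scope.
Variable R : comNzRingType.

Definition ovp_series m : fps R := Fps (fun n => (novps m n)%:R).

(** Classification by the largest part [j]: plain with [j <= m], or overlined with [j < m]. The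
    parts after it are counted by [ovp_series j]. *)
Lemma ovp_series_rec m : ovp_series m = 1 +
  \sum_(1 <= j < m.+1 | A j) fpsXn R j * ovp_series j +
  \sum_(1 <= j < m | A j) fpsXn R j * ovp_series j.
Proof.
have -> : ovp_series m = 1 + \sum_(y <- marked m | overpart_rel (m, true) y && A y.1)
    fpsXn R y.1 * ovp_series y.1.
  apply: fpsP => n; rewrite fpsDE fps1E fps_sumE [LHS]/= novps_rec natrD natr_sum.
  by congr (_ + _); apply: eq_bigr => y _; rewrite fpsXnME /=; case: leqP.
rewrite -addrA; congr (_ + _).
rewrite big_mkcond big_allpairs_dep /=.
under eq_bigr => j _ do rewrite !big_cons big_nil addr0
  /overpart_rel /= !andbT andbF orbF.
rewrite big_split /= addrC; congr (_ + _).
  rewrite -big_mkcond /index_iota subSS subn0 big_seq_cond [RHS]big_seq_cond.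
  by apply: eq_bigl => j; rewrite mem_iota; case: (A j); lia.
case: m => [|m]; first by rewrite !big_nil.
have -> : iota 1 m.+1 = iota 1 m ++ [:: m.+1] by rewrite -[m.+1]addn1 iotaD add1n addn1.
rewrite -big_mkcond /index_iota subSS subn0 big_cat /=.
rewrite [X in _ + X]big_cons big_nil ltnn addr0 /=.
rewrite big_seq_cond [RHS]big_seq_cond; apply: eq_bigl => j.
by rewrite mem_iota; case: (A j); lia.
Qed.

(** The recurrences at [m] and [m.+1] share the sum [S] over [j < m]. Eliminating it leaves the
    ratio (1 + q^m) / (1 - q^(m+1)), with q^j read as 0 when [j] is outside [A]. *)
Lemma ovp_series_step m : (0 < m)%N ->
  ovp_series m.+1 * (if A m.+1 then 1 - fpsXn R m.+1 else 1) =
  ovp_series m * (if A m then 1 + fpsXn R m else 1).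
Proof.
move=> m0; have := ovp_series_rec m.+1; have := ovp_series_rec m.
rewrite !(big_mkcond (fun j => A j)) /= !(big_nat_recr _ _ _ (ltn0Sn m)) /=.
rewrite !(big_nat_recr _ _ _ m0) /=; set S := \sum_(1 <= j < m) _.
pose c j : fps R := if A j then fpsXn R j else 0.
have cE j g : (if A j then fpsXn R j * g else 0) = c j * g.
  by rewrite /c; case: ifP; rewrite ?mul0r.
have -> : (if A m.+1 then 1 - fpsXn R m.+1 else 1) = 1 - c m.+1.
  by rewrite /c; case: ifP; rewrite ?subr0.
have -> : (if A m then 1 + fpsXn R m else 1) = 1 + c m.
  by rewrite /c; case: ifP; rewrite ?addr0.
rewrite !cE => em eSm; transitivity (1 + S + S + c m * ovp_series m *+ 2).
  by rewrite mulrBr mulr1 {1}eSm; ring.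
by rewrite mulrDr mulr1 {2}em; ring.
Qed.

(** The numerator stops at [m] because [ovp_series m.+1] does not allow [m.+1] to be overlined. *)
Lemma ovp_series_prod m :
  ovp_series m.+1 * \prod_(1 <= j < m.+2 | A j) (1 - fpsXn R j) =
  \prod_(1 <= j < m.+1 | A j) (1 + fpsXn R j).
Proof.
rewrite [in LHS]big_mkcond [in RHS]big_mkcond /=; elim: m => [|m IHm].
  rewrite [RHS]big_geq // big_nat1 /=; have := ovp_series_rec 1.
  rewrite [X in _ + X]big_geq // addr0 big_mkcond big_nat1 /=; case: (A 1) => [e|->].
    by rewrite mulrBr mulr1 {1}e; ring.
  by rewrite addr0 mulr1.
rewrite big_nat_recr //= [in RHS]big_nat_recr //= -IHm.
by rewrite mulrCA ovp_series_step // mulrCA mulrA.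
Qed.

End Series.
End Overpartitions.

(** As [n < m], no part equals [m], so the ban on overlining [m] is void. *)
Lemma Bbar_novps l1 l2 n m : n < m ->
  Bbar l1 l2 n = novps (fun j => ~~ (l1 %| j) && ~~ (l2 %| j)) m n.
Proof.
move=> lt_nm; rewrite /Bbar cardE -(size_map (@bseq_parts n)).
apply/perm_size/uniq_perm.
- by rewrite map_inj_uniq ?enum_uniq //; apply: bseq_parts_inj.
- exact: ovps_uniq.
move=> s; rewrite mem_ovps.
have -> : (s \in [seq bseq_parts i | i <- enum [set s : {bseq n of 'I_n.+1 * bool} |
   is_overpartition n (bseq_parts s) && regular2 l1 l2 (bseq_parts s)]]) =
   is_overpartition n s && regular2 l1 l2 s.
  apply/mapP/idP => [[t]|/andP[ov reg]]; first by rewrite mem_enum inE => ? ->.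
  have [t def_s] := overpartition_bseq ov.
  by exists t; rewrite // mem_enum inE def_s ov.
rewrite /is_overpartition /regular2; apply/idP/idP.
  move=> /andP[/and3P[sort_s pos sum_n] ->]; rewrite pos sum_n !andbT /=.
  have le_sn : size s <= n.
    rewrite -(eqP sum_n); elim: s pos {sum_n sort_s} => //= x s IHs /andP[x0 /IHs le_s].
    by rewrite -add1n leq_add.
  rewrite le_sn; case: s sort_s sum_n {pos le_sn} => //= y s -> /eqP sum_n.
  by rewrite /overpart_rel /= andbT (leq_trans _ lt_nm) // ltnS -sum_n leq_addr.
by move=> /and5P[_ /path_sorted -> -> -> ->].
Qed.

(** * Theta series and Gauss's product *)

Section Shanks.
Local Open Scope ring_scope.
Variables (T : comNzRingType) (Q : T).

(** Denominators are cleared, so that the identity holds for any [Q] in any commutative ring. *)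
Definition shanks_term n s : T :=
  (-1) ^+ s * Q ^+ (s * n.+1) * \prod_(s.+1 <= x < n.+1) (1 - Q ^+ x)
  * \prod_(1 <= x < s) (1 + Q ^+ x).

Definition shanks_sum n m : T :=
  \prod_(1 <= x < n.+1) (1 - Q ^+ x) + 2 * \sum_(1 <= s < m.+1) shanks_term n s.

(** With the range of [s] fixed, raising [n] multiplies the sum by [1 + Q ^+ n.+1] up to one
    boundary term, which telescopes in [m]. *)
Lemma shanks_telescope n m : (m <= n)%N ->
  shanks_sum n.+1 m = (1 + Q ^+ n.+1) * shanks_sum n m
  + 2 * ((-1) ^+ m.+1 * Q ^+ (m.+1 * n.+1)
         * \prod_(m.+1 <= x < n.+1) (1 - Q ^+ x)
         * \prod_(1 <= x < m.+1) (1 + Q ^+ x)).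
Proof.
rewrite /shanks_sum; elim: m => [|m IHm] le_mn.
  by rewrite !(@big_geq _ _ _ 1 1) // big_nat_recr //= mul1n expr1; ring.
rewrite !(@big_nat_recr _ _ _ m.+1 1) //= mulrDr addrA IHm 1?ltnW //.
rewrite /shanks_term (@big_nat_recr _ _ _ n.+1 m.+2) //=.
rewrite (@big_ltn _ _ _ m.+1 n.+1) //=.
rewrite !mulnS !mulSn !exprD !exprS; ring.
Qed.

(** The first factor is a partial sum of phi(-Q). On the right every [shanks_term] carries Q^(s
    (n+1)), so Gauss's product holds modulo Q^(n+1). *)
Lemma shanks_identity n :
  (1 + 2 * \sum_(1 <= j < n.+1) (-1) ^+ j * Q ^+ (j * j))
    * \prod_(1 <= x < n.+1) (1 + Q ^+ x) =
  shanks_sum n n.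
Proof.
elim: n => [|n IHn]; first by rewrite /shanks_sum !big_geq //; ring.
have -> : shanks_sum n.+1 n.+1 = shanks_sum n.+1 n + 2 * shanks_term n.+1 n.+1.
  by rewrite /shanks_sum [X in _ + 2 * X = _]big_nat_recr //= mulrDr addrA.
(* The boundary term at [m = n] and the new summand [s = n.+1] differ by a factor Q^(n+1); together
   they give the next square exponent times 1 + Q^(n+1). *)
rewrite shanks_telescope // -IHn.
rewrite !(@big_nat_recr _ _ _ n.+1 1) //= /shanks_term.
rewrite [\prod_(n.+2 <= _ < _) _]big_geq // [\prod_(n.+1 <= _ < _) _]big_geq //.
by rewrite [(n.+1 * n.+2)%N]mulnS exprD; ring.
Qed.

End Shanks.

(** * Theta series as sums over integer windows *)

Section Theta.
Local Open Scope ring_scope.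

Definition zbox B : seq int := [seq i%:Z - B%:Z | i <- iota 0 B.*2.+1].

Arguments zbox : simpl never.

Lemma zbox_uniq B : uniq (zbox B).
Proof. by rewrite map_inj_uniq ?iota_uniq // => i j; lia. Qed.

Lemma mem_zbox B (x : int) : (x \in zbox B) = (`|x| <= B)%N.
Proof.
apply/mapP/idP => [[i]|le_xB]; first by rewrite mem_iota; lia.
by exists (absz (x + B%:Z)); rewrite ?mem_iota; lia.
Qed.

Lemma big_zboxS (V : nmodType) B (F : int -> V) :
  \sum_(x <- zbox B.+1) F x =
  \sum_(x <- zbox B) F x + (F (B.+1%:Z) + F (- B.+1%:Z)).
Proof.
rewrite (perm_big (zbox B ++ [:: B.+1%:Z; - B.+1%:Z])).
  by rewrite big_cat /= !big_cons big_nil addr0.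
apply: uniq_perm; rewrite ?zbox_uniq //; last first.
  by move=> x; rewrite mem_cat !mem_zbox !inE; lia.
by rewrite cat_uniq zbox_uniq /= !mem_zbox; lia.
Qed.

Lemma big_zbox (V : nmodType) B (F : int -> V) :
  \sum_(x <- zbox B) F x =
  F 0 + \sum_(1 <= j < B.+1) (F j%:Z + F (- j%:Z)).
Proof.
elim: B => [|B IHB]; last by rewrite big_zboxS IHB [in RHS]big_nat_recr //= addrA.
by rewrite [in RHS]big_geq // addr0 big_seq1.
Qed.

Definition zbox2 B : seq (int * int) := [seq (x, y) | x <- zbox B, y <- zbox B].

Lemma zbox2_uniq B : uniq (zbox2 B).
Proof. by rewrite allpairs_uniq ?zbox_uniq // => -[? ?] []. Qed.

Lemma mem_zbox2 B u : (u \in zbox2 B) = (`|u.1| <= B)%N && (`|u.2| <= B)%N.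
Proof.
case: u => x y; rewrite -!mem_zbox; apply/allpairsP/andP.
  by case=> -[x' y'] /= [? ? [-> ->]].
by case=> ? ?; exists (x, y).
Qed.

Lemma sum_bij (V : nmodType) (T T' : eqType) (s : seq T) (s' : seq T')
    (P : pred T) (P' : pred T') (w : T -> V) (w' : T' -> V)
    (f : T -> T') (g : T' -> T) :
    uniq s -> uniq s' ->
    (forall x, x \in s -> P x ->
      [/\ f x \in s', P' (f x), g (f x) = x & w x = w' (f x)]) ->
    (forall y, y \in s' -> P' y -> [/\ g y \in s, P (g y) & f (g y) = y]) ->
  \sum_(x <- s | P x) w x = \sum_(y <- s' | P' y) w' y.
Proof.
move=> us us' fP gP.
transitivity (\sum_(x <- [seq x <- s | P x]) w' (f x)).
  rewrite big_filter [LHS]big_seq_cond [RHS]big_seq_cond.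
  by apply: eq_bigr => x /andP[xs Px]; have [] := fP x xs Px.
rewrite -(big_map f xpredT) -[RHS]big_filter; apply: perm_big.
apply: uniq_perm; rewrite ?filter_uniq // ?map_inj_in_uniq ?filter_uniq //.
  move=> x y; rewrite !mem_filter => /andP[Px xs] /andP[Py ys].
  by case: (fP x xs Px) => _ _ gx _; case: (fP y ys Py) => _ _ gy _ fxy; rewrite -gx fxy.
move=> y; rewrite mem_filter; apply/mapP/andP => [[x]|[P'y ys']].
  by rewrite mem_filter => /andP[Px xs] ->; case: (fP x xs Px).
have [gs Pg fg] := gP y ys' P'y.
by exists (g y); rewrite // mem_filter Pg.
Qed.

Variable R : comNzRingType.

(* The terms of exponent n all lie in the box of size n + 1 when [e] is proper. *)
Definition theta (e : int -> nat) (w : int -> R) : fps R :=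
  Fps (fun n => \sum_(x <- zbox n.+1 | e x == n) w x).

(** The slack of one is for triangular exponents, where [tri (-1) = 0]. *)
Definition proper_exp (e : int -> nat) := forall x, (`|x| <= (e x).+1)%N.

Lemma thetaE e w n B : proper_exp e -> (n < B)%N ->
  theta e w n = \sum_(x <- zbox B | e x == n) w x.
Proof.
move=> pe lt_nB; apply: (sum_bij (f := id) (g := id)); rewrite ?zbox_uniq //.
  by move=> x; rewrite !mem_zbox => _ /eqP en; split; rewrite ?en //; move: (pe x); lia.
by move=> x; rewrite !mem_zbox => _ /eqP en; split; rewrite ?en //; move: (pe x); lia.
Qed.

(** Coefficients of products become weighted counts of lattice points, to which the bijections below
    apply. *)
Lemma thetaM e w e' w' n B : proper_exp e -> proper_exp e' -> (n < B)%N ->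
  (theta e w * theta e' w') n =
  \sum_(u <- zbox2 B | (e u.1 + e' u.2)%N == n) w u.1 * w' u.2.
Proof.
move=> pe pe' lt_nB; rewrite fpsME.
transitivity (\sum_(i < n.+1) \sum_(x <- zbox B) \sum_(y <- zbox B)
   (if (e x == i) && (e' y == n - i)%N then w x * w' y else 0)).
  apply: eq_bigr => i _; have lti := ltn_ord i.
  rewrite !(@thetaE _ _ _ B) //; try lia.
  rewrite big_mkcond /= big_distrl; apply: eq_bigr => x _ /=.
  rewrite big_mkcond /= big_distrr; apply: eq_bigr => y _ /=.
  by case: eqP; case: eqP; rewrite /= ?mul0r ?mulr0.
rewrite exchange_big [RHS]big_mkcond big_allpairs_dep /=; apply: eq_bigr => x _.
rewrite exchange_big; apply: eq_bigr => y _ /=.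
case: eqP => [en|ne].
  have ltx : (e x < n.+1)%N by lia.
  rewrite (bigD1 (Ordinal ltx)) //= eqxx (_ : _ == _); last by apply/eqP; lia.
  rewrite big1 ?addr0 //= => i; rewrite -val_eqE /= eq_sym => /negbTE ->.
  by [].
rewrite big1 // => i _; have lti := ltn_ord i.
by case: ifP => // /andP[/eqP ? /eqP ?]; lia.
Qed.

Definition zsign (x : int) : R := (-1) ^+ `|x|%N.
Definition sqd d (x : int) : nat := (d * (`|x| * `|x|))%N.
(** The series phi(-q^d). *)
Definition phim d : fps R := theta (sqd d) zsign.

Lemma proper_sqd d : (0 < d)%N -> proper_exp (sqd d).
Proof. by rewrite /sqd => d0 x; nia. Qed.

Lemma phim_partial d n : (0 < d)%N -> fps_eqmod n.+1 (phim d)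
  (1 + 2 * \sum_(1 <= j < n.+1) (-1) ^+ j * fpsXn R d ^+ (j * j)).
Proof.
move=> d0 i lti; rewrite /phim (@thetaE _ _ _ n.+1) //; last exact: proper_sqd.
rewrite big_mkcond big_zbox fpsDE fps1E; congr (_ + _).
  by rewrite /sqd /zsign /= !muln0; case: (i).
(* The outermost points of the window have exponent d (n+1)^2, which exceeds [i]. *)
rewrite big_nat_recr // [LHS]/= [X in _ + X = _](_ : _ = 0); last first.
  have /negbTE ne : (d * (n.+1 * n.+1))%N != i by apply/eqP; nia.
  by rewrite /sqd abszN absz_nat ne addr0.
rewrite addr0 mulr_sumr fps_sumE; apply: eq_big_nat => j _.
rewrite fpsXnX /sqd /zsign abszN absz_nat.
have sgn_nat (f : fps R) : ((-1) ^+ j * f) i = (-1) ^+ j * f i.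
  by elim: (j) => [|j' IHj]; rewrite ?expr0 ?mul1r //
    !exprS !mulN1r mulNr fpsNE IHj mulNr.
rewrite mulr_natl mulr2n fpsDE sgn_nat /= eq_sym; case: eqP => _; last by rewrite mulr0.
by rewrite mulr1.
Qed.

Lemma phim_prod d n : (0 < d)%N ->
  fps_eqmod n.+1 (phim d * \prod_(1 <= x < n.+1) (1 + fpsXn R (d * x)))
    (\prod_(1 <= x < n.+1) (1 - fpsXn R (d * x))).
Proof.
move=> d0.
have -> : \prod_(1 <= x < n.+1) (1 + fpsXn R (d * x)) =
          \prod_(1 <= x < n.+1) (1 + fpsXn R d ^+ x).
  by apply: eq_bigr => x _; rewrite fpsXnX.
have -> : \prod_(1 <= x < n.+1) (1 - fpsXn R (d * x)) =
          \prod_(1 <= x < n.+1) (1 - fpsXn R d ^+ x).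
  by apply: eq_bigr => x _; rewrite fpsXnX.
apply: (eqmod_trans (eqmodM (phim_partial (n := n) d0) (@eqmod_refl _ _ _))).
rewrite shanks_identity /shanks_sum => i lti; rewrite fpsDE -[RHS]addr0.
congr (_ + _); rewrite mulr_sumr fps_sumE big_nat big1 // => s /andP[s0 _].
(* Each term is divisible by q^(d s (n+1)) with s >= 1, hence vanishes below degree n + 1. *)
rewrite /shanks_term fpsXnX -!mulrA 2!(mulrCA _ (fpsXn _ _)) fpsXnME.
by rewrite leqNgt (_ : (_ < _)%N) //; nia.
Qed.

End Theta.

(** * The generating function of Bbar 2 9 *)

Section GeneratingFunction.
Local Open Scope ring_scope.

Lemma big_multiples (T : comNzRingType) d n (F : nat -> T) : (0 < d)%N ->
  \prod_(1 <= m < (d * n).+1 | (d %| m)%N) F m = \prod_(1 <= j < n.+1) F (d * j)%N.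
Proof.
move=> d0; rewrite -big_filter -(big_map (muln d) xpredT).
apply: perm_big; apply: uniq_perm.
- by rewrite filter_uniq // iota_uniq.
- by rewrite map_inj_uniq ?iota_uniq // => x y /eqP; rewrite eqn_pmul2l // => /eqP.
move=> i; rewrite mem_filter mem_index_iota; apply/andP/mapP.
  move=> [/dvdnP[j ->]] /andP[j0 ltj]; exists j; last by rewrite mulnC.
  rewrite mem_index_iota; move: j0 ltj; rewrite muln_gt0 !ltnS => /andP[-> _] /=.
  by rewrite mulnC leq_pmul2l.
case=> j; rewrite mem_index_iota !ltnS => /andP[j0 ltj] ->.
by rewrite dvdn_mulr // muln_gt0 d0 j0 leq_pmul2l.
Qed.

(** Inclusion-exclusion without division: 2 and 9 are coprime, so 18 divides [m] exactly when both
    do. The condition [1 %| m] gives the full product the same shape as the others. *)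
Lemma prod_incl_excl (T : comNzRingType) n (F : nat -> T) :
  \prod_(1 <= m < n | ~~ (2 %| m)%N && ~~ (9 %| m)%N) F m
    * \prod_(1 <= m < n | (2 %| m)%N) F m
    * \prod_(1 <= m < n | (9 %| m)%N) F m =
  \prod_(1 <= m < n | (1 %| m)%N) F m * \prod_(1 <= m < n | (18 %| m)%N) F m.
Proof.
rewrite (big_mkcond (fun m => _ && _)) 4!(big_mkcond (fun m => _ %| m)%N) /=.
rewrite -!big_split /=; apply: eq_bigr => m _.
rewrite dvd1n (_ : (18 %| m)%N = (2 %| m)%N && (9 %| m)%N); last first.
  by rewrite -(@Gauss_dvd 2 9).
by case: (2 %| m)%N; case: (9 %| m)%N; rewrite /= ?mul1r ?mulr1.
Qed.

Variable R : comNzRingType.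

Lemma phim_multiples d K n : (0 < d)%N -> (d %| n)%N -> (K <= (n %/ d).+1)%N ->
  fps_eqmod K (phim R d * \prod_(1 <= m < n.+1 | (d %| m)%N) (1 + fpsXn R m))
    (\prod_(1 <= m < n.+1 | (d %| m)%N) (1 - fpsXn R m)).
Proof.
move=> d0 /dvdnP[m ->]; rewrite mulnK // mulnC => leK.
rewrite !big_multiples //; apply: eqmod_le leK _; exact: phim_prod.
Qed.

Definition Bbar29 : fps R := Fps (fun n => (Bbar 2 9 n)%:R).

Lemma prod_const1 I (r : seq I) (P : pred I) (F : I -> fps R) :
  (forall i, P i -> F i 0%N = 1) -> (\prod_(i <- r | P i) F i) 0%N = 1.
Proof.
move=> F1; apply: (big_ind (fun f : fps R => f 0%N = 1)) => // f g f1 g1.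
by rewrite fpsM0 f1 g1 mulr1.
Qed.

Lemma Bbar29_prod n : let A j := ~~ (2 %| j)%N && ~~ (9 %| j)%N in
  fps_eqmod n.+1 (Bbar29 * \prod_(1 <= j < n.+1 | A j) (1 - fpsXn R j))
    (\prod_(1 <= j < n.+1 | A j) (1 + fpsXn R j)).
Proof.
move=> A; rewrite -ovp_series_prod; apply: eqmodM.
  by move=> i lti; rewrite /= (@Bbar_novps _ _ _ n.+1).
(* The extra factor at [n.+1] is 1 modulo q^(n+1). *)
rewrite [X in fps_eqmod _ _ X]big_mkcond big_nat_recr //= -big_mkcond /=.
move=> i lti; set P := \prod_(_ <= _ < _ | _) _.
case: ifP => _; last by rewrite mulr1.
rewrite mulrBr mulr1 [P * _]mulrC fpsBE fpsXnME leqNgt lti.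
by rewrite subr0.
Qed.

Lemma Bbar29_phim : Bbar29 * phim R 1 * phim R 18 = phim R 2 * phim R 9.
Proof.
(* Each [d] dividing 18 divides [M] and has at least [n] multiples up to [M], enough for the product
   of phi(-q^d) modulo q^(n+1). *)
apply: fpsP => n; set M := (18 * n)%N.
have dM d : (0 < d)%N -> (d %| 18)%N -> (d %| M)%N /\ (n.+1 <= (M %/ d).+1)%N.
  move=> d0 d18; split; first exact: dvdn_mulr.
  by rewrite ltnS leq_divRL // mulnC leq_mul // dvdn_leq.
have ph d : (0 < d)%N -> (d %| 18)%N -> _ :=
  fun d0 d18 => @phim_multiples d n.+1 M d0 (dM d d0 d18).1 (dM d d0 d18).2.
have le_nM : (n.+1 <= M.+1)%N by rewrite ltnS leq_pmull.
have eB := eqmod_le le_nM (@Bbar29_prod M : fps_eqmod M.+1 _ _).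
pose PA (P : pred nat) : fps R := \prod_(1 <= m < M.+1 | P m) (1 + fpsXn R m).
pose PC (P : pred nat) : fps R := \prod_(1 <= m < M.+1 | P m) (1 - fpsXn R m).
pose A0 := PA (fun j => ~~ (2 %| j)%N && ~~ (9 %| j)%N).
pose C0 := PC (fun j => ~~ (2 %| j)%N && ~~ (9 %| j)%N).
pose Ad d := PA (dvdn d); pose Cd d := PC (dvdn d).
have eA : A0 * Ad 2%N * Ad 9%N = Ad 1%N * Ad 18%N := prod_incl_excl _ _.
have eC : C0 * Cd 2%N * Cd 9%N = Cd 1%N * Cd 18%N := prod_incl_excl _ _.
have {}ph d (d0 : (0 < d)%N) (d18 : (d %| 18)%N) :
  fps_eqmod n.+1 (phim R d * Ad d) (Cd d) := ph d d0 d18.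
have {}eB : fps_eqmod n.+1 (Bbar29 * C0) A0 := eB.
have A0E d : (Ad d) 0%N = 1.
  rewrite /Ad /PA big_nat_cond; apply: prod_const1 => -[|i] // _.
  by rewrite fpsDE fps1E /= addr0.
(* This factor has constant term 1 and clears the denominators on both sides. *)
apply: (@eqmod_mulIf _ n.+1 (Ad 1%N * Ad 18%N)) => //.
  by rewrite fpsM0 !A0E mulr1.
have -> : Ad 1%N * Ad 18%N * (Bbar29 * phim R 1 * phim R 18) =
  Bbar29 * ((phim R 1 * Ad 1%N) * (phim R 18 * Ad 18%N)) by ring.
have -> : Ad 1%N * Ad 18%N * (phim R 2 * phim R 9) =
  A0 * ((phim R 2 * Ad 2%N) * (phim R 9 * Ad 9%N)) by rewrite -eA; ring.
apply: (@eqmod_trans _ _ (Bbar29 * (Cd 1%N * Cd 18%N))).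
  by apply: eqmodM => //; apply: eqmodM; apply: ph.
rewrite -eC -mulrA mulrA; apply: eqmodM => //.
by apply: eqmodM; apply: eqmod_sym; apply: ph.
Qed.

End GeneratingFunction.

(** * Lattice points on binary quadratic forms *)

Section Lattice.
Local Open Scope ring_scope.
Variable R : comNzRingType.

Lemma theta_dilate d e e' (w : int -> R) : (0 < d)%N -> proper_exp e ->
  (forall x, e' x = (d * e x)%N) -> theta e' w = dilate d (theta e w).
Proof.
move=> d0 pe e'E; apply: fpsP => n; rewrite dilateE.
case: ifP => [/dvdnP[m ->]|ndn].
  have pe' : proper_exp e' by move=> x; rewrite e'E; move: (pe x); nia.
  rewrite mulnK // (@thetaE _ _ _ _ (m * d).+1) //.
  rewrite (@thetaE _ _ _ _ (m * d).+1) //; last by nia.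
  by apply: eq_bigl => x; rewrite e'E mulnC eqn_pmul2r.
rewrite /= big1 // => x /eqP en; move/negP: ndn; case.
by rewrite -en e'E dvdn_mulr.
Qed.

(** Properness puts every solution inside its box, so [f] and [g] need only be mutually inverse
    between the two solution sets. *)
Lemma theta_bij (V : nmodType) e1 e2 e1' e2' N N' B B' (C C' : pred (int * int))
    (w w' : int * int -> V) (f g : int * int -> int * int) :
    proper_exp e1 -> proper_exp e2 -> proper_exp e1' -> proper_exp e2' ->
    (N < B)%N -> (N' < B')%N ->
    (forall u, (e1 u.1 + e2 u.2)%N = N -> C u ->
      [/\ (e1' (f u).1 + e2' (f u).2)%N = N', C' (f u), g (f u) = u
        & w u = w' (f u)]) ->
    (forall u, (e1' u.1 + e2' u.2)%N = N' -> C' u ->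
      [/\ (e1 (g u).1 + e2 (g u).2)%N = N, C (g u) & f (g u) = u]) ->
  \sum_(u <- zbox2 B | ((e1 u.1 + e2 u.2)%N == N) && C u) w u =
  \sum_(u <- zbox2 B' | ((e1' u.1 + e2' u.2)%N == N') && C' u) w' u.
Proof.
move=> p1 p2 p1' p2' ltN ltN' fP gP.
apply: (sum_bij (f := f) (g := g)); rewrite ?zbox2_uniq //.
  move=> u _ /andP[/eqP eN Cu]; have [eN' C'u gf wf] := fP u eN Cu.
  split=> //; last by rewrite eN' eqxx.
  by rewrite mem_zbox2 (leq_trans (p1' _)) ?(leq_trans (p2' _)) //
    (leq_trans _ ltN') // ltnS -eN' ?leq_addr ?leq_addl.
move=> u _ /andP[/eqP eN Cu]; have [eN' C'u gf] := gP u eN Cu.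
split=> //; last by rewrite eN' eqxx.
by rewrite mem_zbox2 (leq_trans (p1 _)) ?(leq_trans (p2 _)) //
  (leq_trans _ ltN) // ltnS -eN' ?leq_addr ?leq_addl.
Qed.

Lemma sqdZ d x : (sqd d x)%:Z = d%:Z * (x * x).
Proof. by rewrite /sqd; nia. Qed.

Lemma int_parity (x : int) : {j | x = 2 * j} + {j | x = 2 * j + 1}.
Proof.
by case: (boolP (2 %| x)%Z) => h;
  [left; exists (x %/ 2)%Z | right; exists (x %/ 2)%Z]; lia.
Qed.

(** The quotient is non-negative for every integer [k], so [absz] only changes its type. *)
Definition tri (k : int) : nat := absz (k * (k + 1) %/ 2)%Z.

Lemma triZ k : 2 * (tri k)%:Z = k * (k + 1).
Proof.
have [[j ->]|[j ->]] := int_parity k.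
  by rewrite /tri -mulrA mulKz //; nia.
rewrite /tri.
have -> : (2 * j + 1) * (2 * j + 1 + 1) = 2 * ((2 * j + 1) * (j + 1)) by ring.
rewrite mulKz // gez0_abs //.
by case: (lerP 0 j) => hj; nia.
Qed.

Lemma proper_tri : proper_exp tri.
Proof. by move=> k; move: (triZ k); nia. Qed.

Definition tri3 k := (3 * tri k)%N.

Lemma proper_tri3 : proper_exp tri3.
Proof. by move=> k; move: (proper_tri k); rewrite /tri3; lia. Qed.

Lemma proper_sq1 : proper_exp (sqd 1). Proof. exact: proper_sqd. Qed.
Lemma proper_sq3 : proper_exp (sqd 3). Proof. exact: proper_sqd. Qed.

Definition rep13 N : R :=
  \sum_(u <- zbox2 N.+1 | (sqd 1 u.1 + sqd 3 u.2)%N == N) 1.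

Lemma rep13_true N : rep13 N = \sum_(u <- zbox2 N.+1 |
  ((sqd 1 u.1 + sqd 3 u.2)%N == N) && true) 1.
Proof. by apply: eq_bigl => u; rewrite andbT. Qed.

(** Twice Ramanujan's psi(q), as k and -1 - k have the same exponent; [Psi3] is Psi(q^3). *)
Definition Psi : fps R := theta tri (fun=> 1).
Definition Psi3 : fps R := theta tri3 (fun=> 1).

Lemma sq13_odd a b i : (sqd 1 a + sqd 3 b)%N = (2 * i + 1)%N ->
  (2 %| a - b - 1)%Z.
Proof.
have [[c ec]|[c ec]] := int_parity a; have [[d ed]|[d ed]] := int_parity b;
  move: (sqdZ 1 a) (sqdZ 3 b); rewrite ec ed; nia.
Qed.

(** With X = 2k + 1 and Y = 2l + 1 the points satisfy X^2 + 3 Y^2 = 4 (2i + 1). Multiplying (X + Y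
    sqrt -3) / 2 by (1 - sqrt -3) / 2 when k - l is even, by (1 + sqrt -3) / 2 otherwise, lands in
    Z[sqrt -3]. Each case is a bijection, whence the factor 2. *)
Lemma PsiM_rep13 i : (Psi * Psi3) i = rep13 (2 * i + 1) *+ 2.
Proof.
rewrite (@thetaM _ _ _ _ _ _ i.+1) //; [|exact: proper_tri|exact: proper_tri3].
rewrite (bigID (fun u : int * int => (2 %| u.1 - u.2)%Z)) /= mulr2n; congr (_ + _).
  (* Up to conjugation: the image is ((X + 3Y) / 4, (X - Y) / 4). *)
  pose f (u : int * int) : int * int :=
    (2 * u.2 + 1 + ((u.1 - u.2)%R %/ 2)%Z, ((u.1 - u.2)%R %/ 2)%Z).
  pose g (u : int * int) : int * int :=
    (((u.1 + 3 * u.2 - 1)%R %/ 2)%Z, ((u.1 - u.2 - 1)%R %/ 2)%Z).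
  rewrite rep13_true.
  apply: (theta_bij (f := f) (g := g) proper_tri proper_tri3 proper_sq1 proper_sq3) => //.
  - move=> [k l] /= eN kl; have [j ej] : exists j : int, k = l + 2 * j.
      by exists ((k - l) %/ 2)%Z; lia.
    subst k; rewrite /f /g /= (_ : ((l + 2 * j - l) %/ 2)%Z = j); last by lia.
    split; rewrite ?mulr1 //; last by congr (_, _); lia.
    move: (sqdZ 1 (2 * l + 1 + j)) (sqdZ 3 j) (triZ (l + 2 * j)) (triZ l) eN.
    rewrite /tri3; nia.
  move=> [a b] /= eN _.
  have [j ej] : exists j : int, a = b + 1 + 2 * j.
    by exists ((a - b - 1) %/ 2)%Z; move: (sq13_odd eN); lia.
  subst a; rewrite /f /g /=.
  have -> : ((b + 1 + 2 * j + 3 * b - 1) %/ 2)%Z = j + 2 * b by lia.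
  have -> : ((b + 1 + 2 * j - b - 1) %/ 2)%Z = j by lia.
  split; last by congr (_, _); lia.
    move: (sqdZ 1 (b + 1 + 2 * j)) (sqdZ 3 b) (triZ (j + 2 * b)) (triZ j) eN.
    rewrite /tri3; nia.
  by lia.
(* Here the image is ((X - 3Y) / 4, (X + Y) / 4). *)
pose f (u : int * int) : int * int :=
  (((u.1 + u.2 + 1)%R %/ 2)%Z - (2 * u.2 + 1), ((u.1 + u.2 + 1)%R %/ 2)%Z).
pose g (u : int * int) : int * int :=
  (((u.1 + 3 * u.2 - 1)%R %/ 2)%Z, ((u.2 - u.1 - 1)%R %/ 2)%Z).
rewrite rep13_true.
apply: (theta_bij (f := f) (g := g) proper_tri proper_tri3 proper_sq1 proper_sq3) => //.
- move=> [k l] /= eN kl; have [j ej] : exists j : int, k = 2 * j - l - 1.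
    by exists ((k + l + 1) %/ 2)%Z; lia.
  subst k; rewrite /f /g /= (_ : ((2 * j - l - 1 + l + 1)%R %/ 2)%Z = j); last by lia.
  split; rewrite ?mulr1 //; last by congr (_, _); lia.
  move: (sqdZ 1 (j - (2 * l + 1))) (sqdZ 3 j) (triZ (2 * j - l - 1)) (triZ l) eN.
  by rewrite /tri3; nia.
move=> [a b] /= eN _.
have [j ej] : exists j : int, a = b - 1 - 2 * j.
  by exists ((b - a - 1) %/ 2)%Z; move: (sq13_odd eN); lia.
subst a; rewrite /f /g /=.
have -> : ((b - 1 - 2 * j + 3 * b - 1)%R %/ 2)%Z = 2 * b - j - 1 by lia.
have -> : ((b - (b - 1 - 2 * j) - 1)%R %/ 2)%Z = j by lia.
split; last by congr (_, _); lia.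
  move: (sqdZ 1 (b - 1 - 2 * j)) (sqdZ 3 b) (triZ (2 * b - j - 1)) (triZ j) eN.
  by rewrite /tri3; nia.
by lia.
Qed.

(** When x^2 + 3 y^2 = 4N, an even x forces an even y, and both can be halved. *)
Lemma rep13_halve N :
  \sum_(u <- zbox2 (4 * N).+1 |
    ((sqd 1 u.1 + sqd 3 u.2)%N == (4 * N)%N) && (2 %| u.1)%Z) 1 = rep13 N.
Proof.
rewrite rep13_true.
pose f (u : int * int) : int * int := ((u.1 %/ 2)%Z, (u.2 %/ 2)%Z).
pose g (u : int * int) : int * int := (2 * u.1, 2 * u.2).
apply: (theta_bij (f := f) (g := g) proper_sq1 proper_sq3 proper_sq1 proper_sq3) => //.
  move=> [x y] /= eN x2; have [a ea] : exists a : int, x = 2 * a.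
    by exists (x %/ 2)%Z; lia.
  have [b eb] : exists b : int, y = 2 * b.
    have [[b ->]|[b eb]] := int_parity y; first by exists b.
    by move: (sqdZ 1 x) (sqdZ 3 y) eN; rewrite ea eb; nia.
  subst x y; rewrite /f /g /= !mulKz //; split=> //.
  by move: (sqdZ 1 (2 * a)) (sqdZ 3 (2 * b)) (sqdZ 1 a) (sqdZ 3 b); nia.
move=> [a b] /= eN _; rewrite /f /g /= !mulKz //; split=> //; last by lia.
by move: (sqdZ 1 (2 * a)) (sqdZ 3 (2 * b)) (sqdZ 1 a) (sqdZ 3 b); nia.
Qed.

(** Even pairs give one copy by halving; odd pairs (2k + 1, 2l + 1) give the coefficient of
    [Psi * Psi3], hence two more. *)
Lemma rep13_4odd i : rep13 (4 * (2 * i + 1)) = rep13 (2 * i + 1) *+ 3.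
Proof.
rewrite mulrS -PsiM_rep13 -[in RHS]rep13_halve /rep13.
rewrite (bigID (fun u : int * int => (2 %| u.1)%Z)) [LHS]/=; congr (_ + _).
rewrite (@thetaM _ _ _ _ _ _ i.+1) //; [|exact: proper_tri|exact: proper_tri3].
rewrite [RHS](eq_bigl (fun u : int * int => ((tri u.1 + tri3 u.2)%N == i) && true));
  last by move=> u; rewrite andbT.
pose f (u : int * int) : int * int := (((u.1 - 1)%R %/ 2)%Z, ((u.2 - 1)%R %/ 2)%Z).
pose g (u : int * int) : int * int := (2 * u.1 + 1, 2 * u.2 + 1).
apply: (theta_bij (f := f) (g := g) proper_sq1 proper_sq3 proper_tri proper_tri3) => //.
  move=> [x y] /= eN x2; have [a ea] : exists a : int, x = 2 * a + 1.
    by exists (x %/ 2)%Z; lia.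
  have [b eb] : exists b : int, y = 2 * b + 1.
    have [[b eb]|[b ->]] := int_parity y; last by exists b.
    by move: (sqdZ 1 x) (sqdZ 3 y) eN; rewrite ea eb; nia.
  subst x y; rewrite /f /g /= !addrK !mulKz //; split=> //; last by rewrite mulr1.
  move: (sqdZ 1 (2 * a + 1)) (sqdZ 3 (2 * b + 1)) (triZ a) (triZ b).
  by rewrite /tri3; nia.
move=> [a b] /= eN _; rewrite /f /g /= !addrK !mulKz //; split=> //; last by lia.
move: (sqdZ 1 (2 * a + 1)) (sqdZ 3 (2 * b + 1)) (triZ a) (triZ b) eN.
by rewrite /tri3; nia.
Qed.

(** Odd x and y would give x^2 + 3 y^2 = 4 modulo 8, so only even pairs represent a multiple of
    8. *)
Lemma rep13_4even i : rep13 (4 * (2 * i)) = rep13 (2 * i).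
Proof.
rewrite -[RHS]rep13_halve /rep13.
rewrite (bigID (fun u : int * int => (2 %| u.1)%Z)) /= [X in _ + X]big1 ?addr0 //.
move=> [x y] /= /andP[/eqP eN x2].
have [[a ea]|[a ea]] := int_parity x; first by lia.
have [[b eb]|[b eb]] := int_parity y.
  by move: (sqdZ 1 x) (sqdZ 3 y) eN; rewrite ea eb; nia.
move: (sqdZ 1 x) (sqdZ 3 y) (triZ a) (triZ b); rewrite ea eb => sx sy ta tb.
exfalso; move: eN; rewrite ea eb => eN.
have : (4 * (2 * i))%N%:Z = 8 * (tri a)%:Z + 24 * (tri b)%:Z + 4.
  by rewrite -eN PoszD sx sy; nia.
lia.
Qed.

Lemma rep13_2mod4 i : rep13 (4 * i + 2) = 0.
Proof.
rewrite /rep13 big1 // => -[x y] /= /eqP eN; exfalso.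
have [[a ea]|[a ea]] := int_parity x; have [[b eb]|[b eb]] := int_parity y;
  move: (sqdZ 1 x) (sqdZ 3 y) eN; rewrite ea eb; nia.
Qed.

(* For z = 2k + 1, the form 8n + 1 = z^2 + 8x^2 has the isometry
   (x, z) -> ((z - x) / 3, (z + 8x) / 3), which flips the sign (-1)^x. *)
Lemma Psi_phim_isometry n :
  \sum_(u <- zbox2 n.+1 |
     ((tri u.1 + sqd 1 u.2)%N == n) && (3 %| 2 * u.1 + 1 - u.2)%Z)
     zsign R u.2 =
  - \sum_(u <- zbox2 n.+1 |
     ((tri u.1 + sqd 1 u.2)%N == n) && (3 %| 2 * u.1 + 1 - u.2)%Z)
     zsign R u.2.
Proof.
rewrite -sumrN.
pose f (u : int * int) : int * int :=
  (((u.1 + 4 * u.2 - 1)%R %/ 3)%Z, ((2 * u.1 + 1 - u.2)%R %/ 3)%Z).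
have fP u : (tri u.1 + sqd 1 u.2)%N = n -> (3 %| 2 * u.1 + 1 - u.2)%Z ->
  [/\ (tri (f u).1 + sqd 1 (f u).2)%N = n, (3 %| 2 * (f u).1 + 1 - (f u).2)%Z,
      f (f u) = u & zsign R u.2 = - zsign R (f u).2].
  case: u => k x /= eN d3; have [j ej] : exists j : int, x = 2 * k + 1 - 3 * j.
    by exists ((2 * k + 1 - x) %/ 3)%Z; lia.
  subst x; rewrite /f /=.
  have -> : ((k + 4 * (2 * k + 1 - 3 * j) - 1)%R %/ 3)%Z = 3 * k + 1 - 4 * j by lia.
  have -> : ((2 * k + 1 - (2 * k + 1 - 3 * j))%R %/ 3)%Z = j by lia.
  split; [|by lia|by congr (_, _); lia|].
    move: (triZ k) (triZ (3 * k + 1 - 4 * j)) (sqdZ 1 j) (sqdZ 1 (2 * k + 1 - 3 * j)).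
    by nia.
  rewrite /zsign -signr_odd -[in RHS]signr_odd.
  (* The source of the sign: x = 2k + 1 - 3j and its image j have opposite parities. *)
  have -> : odd (absz (2 * k + 1 - 3 * j)%R) = ~~ odd (absz j) by lia.
  by case: odd; rewrite /= ?opprK.
apply: (theta_bij (f := f) (g := f) proper_tri proper_sq1 proper_tri proper_sq1) => //.
by move=> u e d; have [] := fP u e d.
Qed.

Lemma Psi_phim_conj n :
  \sum_(u <- zbox2 n.+1 |
     ((tri u.1 + sqd 1 u.2)%N == n) && (3 %| 2 * u.1 + 1 + u.2)%Z)
     zsign R u.2 =
  \sum_(u <- zbox2 n.+1 |
     ((tri u.1 + sqd 1 u.2)%N == n) && (3 %| 2 * u.1 + 1 - u.2)%Z)
     zsign R u.2.
Proof.
pose f (u : int * int) : int * int := (u.1, - u.2).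
apply: (theta_bij (f := f) (g := f) proper_tri proper_sq1 proper_tri proper_sq1) => //.
  move=> [k x] /= eN d; rewrite /f /= opprK /zsign abszN; split=> //.
  by rewrite /sqd abszN.
by move=> [k x] /= eN d; rewrite /f /= opprK /sqd abszN; split.
Qed.

(** Here k = 3a + 1 and x = 3b, with tri(3a + 1) = 9 tri(a) + 1 and the sign unchanged. The guard
    [0 < n] is there because [n - 1] is 0 at [n = 0]. *)
Lemma Psi_phim_triple n :
  \sum_(u <- zbox2 n.+1 |
     ((tri u.1 + sqd 1 u.2)%N == n) && ((3 %| 2 * u.1 + 1)%Z && (3 %| u.2)%Z))
     zsign R u.2 =
  if (9 %| n - 1)%N && (0 < n)%N then (Psi * phim R 1) ((n - 1) %/ 9)%N else 0.
Proof.
have sub u : (tri u.1 + sqd 1 u.2)%N = n -> (3 %| 2 * u.1 + 1)%Z && (3 %| u.2)%Z ->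
    exists v : int * int, [/\ u = (3 * v.1 + 1, 3 * v.2) &
      n = (9 * (tri v.1 + sqd 1 v.2) + 1)%N].
  case: u => k x /= eN /andP[dk dx].
  exists (((k - 1)%R %/ 3)%Z, (x %/ 3)%Z).
  have [a ea] : exists a : int, k = 3 * a + 1 by exists ((k - 1) %/ 3)%Z; lia.
  have [b eb] : exists b : int, x = 3 * b by exists (x %/ 3)%Z; lia.
  subst k x; rewrite /= addrK !mulKz //; split=> //.
  by move: (triZ a) (triZ (3 * a + 1)) (sqdZ 1 b) (sqdZ 1 (3 * b)); nia.
case: ifP => [/andP[/dvdnP[m em] n0]|nd]; last first.
  rewrite big1 // => u /andP[/eqP eN d]; have [v [_ en]] := sub u eN d.
  by move: nd; rewrite en; lia.
have {em n0 sub} -> : n = (9 * m + 1)%N by lia.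
rewrite (_ : (9 * m + 1 - 1) %/ 9 = m)%N; last by lia.
rewrite (@thetaM _ _ _ _ _ _ m.+1) //; [|exact: proper_tri|exact: proper_sq1].
rewrite [RHS](eq_bigl (fun u : int * int => ((tri u.1 + sqd 1 u.2)%N == m) && true));
  last by move=> u; rewrite andbT.
pose f (u : int * int) : int * int := (((u.1 - 1)%R %/ 3)%Z, (u.2 %/ 3)%Z).
pose g (u : int * int) : int * int := (3 * u.1 + 1, 3 * u.2).
apply: (theta_bij (f := f) (g := g) proper_tri proper_sq1 proper_tri proper_sq1) => //.
  move=> [k x] /= eN /andP[dk dx].
  have [a ea] : exists a : int, k = 3 * a + 1 by exists ((k - 1) %/ 3)%Z; lia.
  have [b eb] : exists b : int, x = 3 * b by exists (x %/ 3)%Z; lia.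
  subst k x; rewrite /f /g /= addrK !mulKz //; split=> //.
    by move: (triZ a) (triZ (3 * a + 1)) (sqdZ 1 b) (sqdZ 1 (3 * b)); nia.
  rewrite mul1r /zsign -signr_odd -[in RHS]signr_odd.
  by have -> : odd (absz (3 * b)%R) = odd (absz b) by lia.
move=> [a b] /= eN _; rewrite /f /g /= addrK !mulKz //; split=> //; last by lia.
by move: (triZ a) (triZ (3 * a + 1)) (sqdZ 1 b) (sqdZ 1 (3 * b)); nia.
Qed.

End Lattice.

(** * Reduction modulo 3 *)

Section ModThree.
Local Open Scope ring_scope.

Local Notation F3 := 'F_3.
Local Notation phi := (phim F3 1).
Local Notation psi := (Psi F3).

Lemma F3_eqN (x : F3) : x = - x -> x = 0.
Proof. by case: x => [[|[|[|]]]] // i /(congr1 val) /= e; apply: val_inj. Qed.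

Lemma F3_mulr3n (x : F3) : x *+ 3 = 0.
Proof. by case: x => [[|[|[|]]]] // i; apply: val_inj. Qed.

Lemma fps3_mulr3n (f : fps F3) : f *+ 3 = 0.
Proof.
by apply: fpsP => n; rewrite fps0E !mulrS mulr0n !fpsDE fps0E
  -[RHS](F3_mulr3n (f n)) !mulrS.
Qed.

(** Descent: multiples of 8 reduce by a factor 4, numbers 4 modulo 8 give a multiple of 3, and
    numbers 2 modulo 4 are not represented. *)
Lemma rep13_even i : (0 < i)%N -> rep13 F3 (2 * i) = 0.
Proof.
elim/ltn_ind: i => i IHi i0.
have [j [ej|ej]] : exists j, i = (2 * j)%N \/ i = (2 * j + 1)%N.
- by exists (i %/ 2)%N; lia.
- have [k [ek|ek]] : exists k, j = (2 * k)%N \/ j = (2 * k + 1)%N.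
    by exists (j %/ 2)%N; lia.
  + have -> : (2 * i = 4 * (2 * k))%N by lia.
    by rewrite rep13_4even IHi //; lia.
  have -> : (2 * i = 4 * (2 * k + 1))%N by lia.
  by rewrite rep13_4odd F3_mulr3n.
have -> : (2 * i = 4 * j + 2)%N by lia.
exact: rep13_2mod4.
Qed.

Lemma phim3 d : (0 < d)%N -> phim F3 (3 * d) = phim F3 d ^+ 3.
Proof.
move=> d0; rewrite fps_cube; apply: theta_dilate => //; first exact: proper_sqd.
by move=> x; rewrite /sqd -mulnA.
Qed.

Lemma Psi3E : Psi3 F3 = psi ^+ 3.
Proof. by rewrite fps_cube; apply: theta_dilate => //; exact: proper_tri. Qed.

Lemma phim2 : phim F3 2 = dilate 2 phi.
Proof.
by apply: theta_dilate => //; [exact: proper_sqd | move=> x; rewrite /sqd mul1n].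
Qed.

Lemma phim_0 d : (0 < d)%N -> phim F3 d 0%N = 1.
Proof.
move=> d0; rewrite (@phim_partial F3 d 0 d0 0%N isT) fpsDE fps1E.
by rewrite big_geq // mulr0 fps0E addr0.
Qed.

Definition rep13_odd : fps F3 := Fps (fun i => rep13 F3 (2 * i + 1)).

Lemma rep13_0 : rep13 F3 0 = 1.
Proof.
rewrite /rep13 (eq_bigl (pred1 ((0, 0) : int * int))).
  by rewrite -big_filter filter_pred1_uniq ?zbox2_uniq ?mem_zbox2 // big_seq1.
move=> [x y] /=; rewrite xpair_eqE; move: (sqdZ 1 x) (sqdZ 3 y).
move=> sx sy; apply/eqP/andP => [e|[/eqP -> /eqP ->]] //.
by split; apply/eqP; nia.
Qed.

(** By Frobenius phi^4 is phi(-q) phi(-q^3). Its sign (-1)^(x + y) is (-1)^n since x + y and x^2 + 3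
    y^2 have the same parity; positive even n contribute 0. *)
Lemma phi4 : phi ^+ 4 = 1 - fpsXn F3 1 * dilate 2 rep13_odd.
Proof.
rewrite exprS -(phim3 (ltn0Sn 0)) muln1; apply: fpsP => n.
rewrite (@thetaM _ _ _ _ _ n n.+1) //; try exact: proper_sqd.
transitivity ((-1) ^+ n * rep13 F3 n).
  rewrite big_distrr; apply: eq_bigr => -[x y] /= /eqP <-.
  rewrite mulr1 /zsign -exprD -[LHS]signr_odd -[RHS]signr_odd.
  have -> // : odd (`|x| + `|y|) = odd (sqd 1 x + sqd 3 y).
  by rewrite /sqd !oddD !oddM; do 2!case: odd.
rewrite fpsBE fps1E fpsXnME dilateE.
have [j [->|->]] : exists j, n = (2 * j)%N \/ n = (2 * j + 1)%N.
- by exists (n %/ 2)%N; lia.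
- rewrite -signr_odd oddM expr0 mul1r; case: j => [|j].
    by rewrite muln0 rep13_0 subr0.
  rewrite rep13_even //= (_ : (2 %| _)%N = false) ?subr0 ?if_same //.
  by apply/negbTE; lia.
rewrite addn1 subn1 /= dvdn_mulr // mulKn // -signr_odd /= oddM expr1 mulN1r sub0r.
by rewrite addn1.
Qed.

(** Modulo 3, phi(-q^9) = phi(-q)^9 and phi(-q^18) = phi(-q^2)^9; the common factor phi(-q)
    phi(-q^2) cancels. *)
Lemma Bbar29_phi8 : phim F3 2 ^+ 8 * Bbar29 F3 = phi ^+ 8.
Proof.
have e := Bbar29_phim F3.
have e9 : phim F3 9 = phi ^+ 9 by rewrite -[9%N]/(3 * (3 * 1))%N !phim3 // -exprM.
have e18 : phim F3 18 = phim F3 2 ^+ 9.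
  by rewrite -[18%N]/(3 * (3 * 2))%N !phim3 // -exprM.
apply: (@fps_mulIf _ (phi * phim F3 2)); first by rewrite fpsM0 !phim_0 // mulr1.
transitivity (Bbar29 F3 * phi * phim F3 2 ^+ 9); first by ring.
by rewrite -e18 e e9; ring.
Qed.

Lemma diss_phi8 : diss 2 1 (phi ^+ 8) = rep13_odd.
Proof.
have -> : phi ^+ 8 = 1 + dilate 2 rep13_odd * fpsXn F3 1
    + dilate 2 rep13_odd * (dilate 2 rep13_odd * fpsXn F3 2).
  rewrite -[8%N]/(4 * 2)%N exprM phi4 -[fpsXn F3 2](fpsXnM F3 1 1).
  set x := fpsXn F3 1; set k := dilate 2 _.
  (* Squaring 1 - xk gives the middle term -2xk, which is xk modulo 3. *)
  rewrite -[LHS]addr0 -(fps3_mulr3n (x * k)); ring.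
have dissD f g : diss 2 1 (f + g) = diss 2 1 f + diss 2 1 g by [].
rewrite !dissD !diss_dilateM //.
have -> : diss 2 1 (1 : fps F3) = 0.
  by apply: fpsP => n; rewrite dissE fps1E fps0E addn1.
have -> : diss 2 1 (fpsXn F3 1) = 1.
  by apply: fpsP => -[|n]; rewrite dissE fps1E //= addn1 mulnS.
have -> : diss 2 1 (fpsXn F3 2) = 0.
  by apply: fpsP => n; rewrite dissE fps0E /=; case: eqP => //; lia.
by ring.
Qed.

(** Frobenius turns Psi(q) Psi(q^3) into Psi^4, and 2 = -1 in F_3. *)
Lemma Psi4 : psi ^+ 4 = - rep13_odd.
Proof.
rewrite exprS -Psi3E; apply: fpsP => i; rewrite PsiM_rep13 fpsNE /=.
by apply/eqP; rewrite -subr_eq0 opprK -mulrSr F3_mulr3n.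
Qed.

Lemma diss_Psi_phi : diss 3 1 (psi * phi) = - (psi * phi) ^+ 3.
Proof.
rewrite fps_cube; apply: fpsP => j; rewrite dissE fpsNE dilateE.
set n := (3 * j + 1)%N.
have <- : (if (9 %| n - 1)%N && (0 < n)%N then (psi * phi) ((n - 1) %/ 9)%N else 0) =
    if (3 %| j)%N then (psi * phi) (j %/ 3)%N else 0.
  rewrite /n addn1 subn1 andbT -[9%N]/(3 * 3)%N dvdn_pmul2l // divnMl //.
rewrite -Psi_phim_triple (@thetaM _ _ _ _ _ n n.+1) //;
  [|exact: proper_tri|exact: proper_sq1].
have zero := F3_eqN (Psi_phim_isometry F3 n).
have zero' := Psi_phim_conj F3 n; rewrite zero in zero'.
pose S (C : pred (int * int)) := \sum_(u <- zbox2 n.+1 |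
  ((tri u.1 + sqd 1 u.2)%N == n) && C u) zsign F3 u.2.
(* Inclusion-exclusion over 3 | z - x and 3 | z + x for z = 2k + 1: the isometry kills both single
   sums, and both conditions hold exactly when 3 divides z and x. *)
transitivity (S (fun u => 3 %| 2 * u.1 + 1 - u.2)%Z
    + S (fun u => 3 %| 2 * u.1 + 1 + u.2)%Z
    - S (fun u => (3 %| 2 * u.1 + 1)%Z && (3 %| u.2)%Z)); last first.
  by rewrite /S zero zero' addr0 add0r.
rewrite /S !big_mkcondr -sumrN -!big_split; apply: eq_bigr => -[k x] /= /eqP en.
rewrite mul1r.
(* For n = 3j + 1, z^2 - x^2 = 8n + 1 - 9 x^2 is divisible by 3. *)
have d3 : (3 %| 2 * k + 1 - x)%Z || (3 %| 2 * k + 1 + x)%Z.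
  rewrite !dvdzE -Euclid_dvdM // -abszM -(dvdzE 3).
  move: (triZ k) (sqdZ 1 x) en; rewrite /n => tk sx en.
  have -> : (2 * k + 1 - x) * (2 * k + 1 + x) = 3 * (8 * j%:Z + 3 - 3 * (x * x)).
    have : (tri k)%:Z + (x * x) = 3 * j%:Z + 1 by nia.
    nia.
  by rewrite dvdz_mulr.
case: ifP => d1; case: ifP => d2; case: ifP => d4;
  rewrite ?subr0 ?addr0 ?add0r ?addrK //; lia.
Qed.

(** With H the series of odd-indexed values, phi^8 H = -Psi^4. Multiplied by phi this reads phi^9 H
    = -Psi^3 (Psi phi), where the cubes are series in q^3; extracting exponents 1 modulo 3 gives
    index 2 (3j + 1) + 1 = 6j + 3. *)
Lemma Bbar_rep13 j : (Bbar 2 9 (6 * j + 3))%:R = - rep13 F3 (2 * j + 1).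
Proof.
have e8 : phi ^+ 8 * diss 2 1 (Bbar29 F3) = rep13_odd.
  by rewrite -(@diss_dilateXM _ 2 1) // -phim2 Bbar29_phi8 diss_phi8.
set H := diss 2 1 _ in e8.
have e9 : dilate 3 (phi ^+ 3) * H = - (dilate 3 psi * (psi * phi)).
  rewrite -!fps_cube -exprM; transitivity (phi * (phi ^+ 8 * H)); first by ring.
  by rewrite e8 -[rep13_odd]opprK -Psi4; ring.
have := congr1 (diss 3 1) e9.
have dissN f : diss 3 1 (- f) = - diss 3 1 f by [].
rewrite dissN !diss_dilateM // diss_Psi_phi => e.
have : diss 3 1 H = - rep13_odd.
  apply: (@fps_mulIf _ (phi ^+ 3)); first by rewrite fpsX_0 // phim_0.
  by rewrite e -Psi4; ring.
move/(congr1 (fun f : fps F3 => f j)); rewrite dissE /H dissE fpsNE /=.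
by have -> : (2 * (3 * j + 1) + 1 = 6 * j + 3)%N by lia.
Qed.

End ModThree.

(** * Inert primes *)

Section Inert.
Local Open Scope ring_scope.
Variable p : nat.
Hypotheses (p_pr : prime p) (p_mod : p = 5 %[mod 6]).

(** As p = 2 modulo 3, cubing is inverted by raising to the power (2p - 1) / 3 = 2 (p %/ 3) + 1. *)
Lemma Fp_cube_inj : injective (fun v : 'F_p => v ^+ 3).
Proof.
have fermat (v : 'F_p) : v ^+ p = v.
  by rewrite -[v]natr_Zp -(pFrobenius_autE (pchar_Fp p_pr)) pFrobenius_aut_nat.
have inv (v : 'F_p) : (v ^+ 3) ^+ (2 * (p %/ 3) + 1) = v.
  rewrite -exprM (_ : (3 * _ = p + (p - 1))%N); last by lia.
  rewrite exprD fermat -exprS (_ : (p - 1).+1 = p) ?fermat //.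
  by have := prime_gt0 p_pr; lia.
by move=> u v /= euv; rewrite -[u]inv euv inv.
Qed.

(* If x^2 = -3 y^2 then (x - y)^3 = (2 y)^3, and cubing is injective mod p. *)
Lemma sq13_inert (x y : int) : (p%:Z %| x * x + 3 * (y * y))%Z ->
  (p%:Z %| x)%Z && (p%:Z %| y)%Z.
Proof.
rewrite !(dvdz_pcharf (pchar_Fp p_pr)) rmorphD !rmorphM /=.
set a : 'F_p := x%:~R; set b : 'F_p := y%:~R; rewrite [3%:~R]/(3%:R : 'F_p) => /eqP e.
have e' : a * a = - (3 * (b * b)) by apply/eqP; rewrite -addr_eq0 e.
have ab : a - b = 2 * b.
  apply: Fp_cube_inj => /=.
  transitivity (a * (a * a) - 3 * (a * a) * b + 3 * a * (b * b) - b * (b * b));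
    first by ring.
  by rewrite e'; ring.
have {}ab : a = 3 * b by rewrite -(subrK b a) ab; ring.
have b0 : 12 * (b * b) = 0.
  by transitivity (a * a + 3 * (b * b)) => //; rewrite ab; ring.
(* No divisor of 12 is 5 modulo 6. *)
have n12 : (12 : 'F_p) != 0.
  rewrite -(dvdn_pcharf (pchar_Fp p_pr)); apply/negP => d12.
  have : p \in divisors 12 by rewrite -dvdn_divisors.
  by rewrite !inE; do 6?[case/orP] => /eqP ep; move: p_mod; rewrite ep.
move/eqP: b0; rewrite mulf_eq0 (negbTE n12) mulf_eq0 orbb /= => /eqP b0.
by rewrite ab b0 mulr0 eqxx.
Qed.

(** Both coordinates of a representation of p^2 m are divisible by p, so scaling by p is a
    bijection. *)
Lemma rep13_inert (R : comNzRingType) m : rep13 R (p * p * m) = rep13 R m.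
Proof.
have p0 : p%:Z != 0 by move: (prime_gt0 p_pr); lia.
pose f (u : int * int) : int * int := ((u.1 %/ p%:Z)%Z, (u.2 %/ p%:Z)%Z).
pose g (u : int * int) : int * int := (p%:Z * u.1, p%:Z * u.2).
have eg a b : (sqd 1 (p%:Z * a) + sqd 3 (p%:Z * b) = p * p * (sqd 1 a + sqd 3 b))%N.
  by rewrite /sqd !abszM absz_nat; ring.
rewrite !rep13_true.
apply: (theta_bij (f := f) (g := g) proper_sq1 proper_sq3 proper_sq1 proper_sq3) => //.
  move=> [x y] /= eN _.
  have : (p%:Z %| x * x + 3 * (y * y))%Z.
    have -> : x * x + 3 * (y * y) = (p * p * m)%N%:Z.
      by rewrite -eN PoszD !sqdZ mul1r.
    by rewrite -mulnA PoszM dvdz_mulr.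
  move=> /sq13_inert /andP[/dvdzP[a ea] /dvdzP[b eb]]; subst x y.
  rewrite /f /g /= !mulzK // !(mulrC p%:Z); split=> //.
  move: eN; rewrite !(mulrC _ p%:Z) eg => /eqP.
  by rewrite eqn_pmul2l ?muln_gt0 ?prime_gt0 // => /eqP.
move=> [a b] /= eN _; rewrite /f /g /= !mulKz //; split=> //.
by rewrite eg eN.
Qed.

End Inert.

(** With s = (6r + 5) / p and m = 6 p^(k-1) n + s, the two arguments are 3 p^2 m and 3m. *)
Theorem theorem3p10 (k p r n : nat) (hk : 0 < k) (hp : prime p)
    (hp5 : p = 5 %[mod 6]) (hr : p %| 6 * r + 5) :
  ((Bbar 2 9 (18 * p ^ (k + 1) * n + 18 * p * r + 15 * p)%N)%:Z =
   (- p%:Z) * (Bbar 2 9 (18 * p ^ (k - 1) * n + (18 * r + 15) %/ p)%N)%:Z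
     %[mod 3])%Z.
Proof.
have p_gt0 := prime_gt0 hp.
have /dvdnP[s es] := hr.
(* From here on [k] is one less than in the statement. *)
case: k hk => // k _; rewrite addn1 subn1 /= !expnS.
set t := p ^ k.
have -> : (18 * r + 15) %/ p = 3 * s.
  by rewrite (_ : 18 * r + 15 = 3 * s * p) ?mulnK // -mulnA -es; lia.
(* m is odd because s divides the odd number 6r + 5. *)
have [j ej] : exists j, 6 * t * n + s = 2 * j + 1.
  exists ((6 * t * n + s) %/ 2).
  have : odd (s * p) by rewrite -es oddD oddM.
  by rewrite oddM => /andP[os _]; lia.
have [i ei] : exists i, p * p * (2 * j + 1) = 2 * i + 1.
  have op : odd p by lia.
  have : odd (p * p * (2 * j + 1)) by rewrite !oddM op oddD oddM.
  by move=> o; exists ((p * p * (2 * j + 1)) %/ 2); lia.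
have -> : 18 * t * n + 3 * s = 6 * j + 3 by lia.
have -> : 18 * (p * (p * t)) * n + 18 * p * r + 15 * p = 6 * i + 3.
  transitivity (3 * (p * p * (6 * t * n + s))); last by rewrite ej ei; lia.
  have -> : 18 * (p * (p * t)) * n + 18 * p * r + 15 * p
     = 3 * (p * p * (6 * t * n)) + 3 * p * (6 * r + 5) by ring.
  by rewrite es; ring.
have e3 : ((Bbar 2 9 (6 * i + 3)%N)%:R = (Bbar 2 9 (6 * j + 3)%N)%:R :> 'F_3)%R.
  by rewrite !Bbar_rep13 -ei rep13_inert.
have : (Bbar 2 9 (6 * i + 3) = Bbar 2 9 (6 * j + 3) %[mod 3])%N.
  by have := congr1 (@nat_of_ord _) e3; rewrite !val_Fp_nat.
move: (Bbar 2 9 _) (Bbar 2 9 _) => b a ab.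
have [q eq] : exists q, p = 3 * q + 2 by exists (p %/ 3); lia.
rewrite eq; apply/eqP; rewrite eqz_mod_dvd.
have [c ec] : exists c : int, (a%:Z = b%:Z + 3 * c)%R.
  by exists (((a%:Z - b%:Z)%R %/ 3)%Z); lia.
(* a + p b = (b + 3c) + (3q + 2) b = 3 (c + q b + b). *)
rewrite ec; apply/dvdzP; exists (c + q%:Z * b%:Z + b%:Z)%R.
by rewrite PoszD PoszM; ring.
Qed.
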